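(* Let $K\ge 2$, $\epsilon\in(0,\tfrac12)$, and let $S:\mathcal X\times[K]\to\mathbb{R}$ be a score function. Let $(X,Y)$ be a clean pair with $Y\in[K]$, and let the observed label $\tilde Y$ equal $Y$ with probability $1-\epsilon$ and a draw $Y^c$ from a corrupting distribution on $[K]$ with probability $\epsilon$, with $\tilde Y$ conditionally independent of $X$ given $Y$. Let $P_i=\mathbb{P}(Y=i)$, $\tilde P_i=\mathbb{P}(\tilde Y=i)>0$, and let $P\in\mathbb{R}^{K\times K}$ with $P_{ji}=\mathbb{P}(Y=j\mid\tilde Y=i)$ be invertible, with inverse entries $P^{-1}_{ji}$. Define $F_1(q)=\mathbb{P}(S(X,Y)\le q)$, $\tilde F(q)=\mathbb{P}(S(X,\tilde Y)\le q)$, $g(q)=F_1(q)-\tilde F(q)$, and $\tilde F(q;i,j)=\mathbb{P}(S(X,i)\le q\mid\tilde Y=j)$. Given i.i.d. calibration data $(X_\ell,\tilde Y_\ell)$, $\ell=1,\dots,n$, distributed as $(X,\tilde Y)$, let $$\tilde F_n(q;i,j)=\frac{\sum_{\ell=1}^n\mathbf 1(S(X_\ell,i)\le q)\mathbf 1(\tilde Y_\ell=j)}{\sum_{\ell=1}^n\mathbf 1(\tilde Y_\ell=j)}\quad(0/0:=0),$$ $$\hat g(q)=\sum_{i=1}^K\sum_{j=1}^K P_iP^{-1}_{ji}\tilde F_n(q;i,j)-\sum_{i=1}^K\tilde P_i\tilde F_n(q;i,i).$$ Set $w^{(1)}_i=P^{-1}_{ii}P_i-\tilde P_i$, $w^{(2)}_{ij}=P_iP^{-1}_{ji}$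 and $b(n,j)=(1-\tilde P_j)^n+\sqrt{\frac{\pi}{n\tilde P_j}}$. Then for any $k\in[n]$, with $S_{(k)}$ the $k$-th order statistic of the calibration scores $S(X_\ell,\tilde Y_\ell)$, $$\mathbb{E}\big[|\hat g(S_{(k)})-g(S_{(k)})|\big]\le B(n,\epsilon):=\sum_{i=1}^K\Big(|w^{(1)}_i|\,b(n,i)+\sum_{j\ne i}|w^{(2)}_{ij}|\,b(n,j)\Big).$$
   Context: $[K]=\{1,\dots,K\}$. All probabilities are with respect to the joint distribution described; the calibration pairs are independent. *)

(* Defs.v *)
From HB Require Import structures.
From mathcomp Require Import all_boot all_order all_algebra.
From mathcomp Require Import all_classical all_reals all_analysis.
Unset Printing Implicit Defensive.
Import Order.TTheory GRing.Theory Num.Theory.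
Local Open Scope classical_set_scope.
Local Open Scope ring_scope.

Section noisy_conformal.
Context {R : realType} {d : measure_display} {T : measurableType d}
  (P : probability T R).

Definition pr (A : set T) : R := fine (P A).

Definition cpr (A B : set T) : R := pr (A `&` B) / pr B.

Context {dX : measure_display} {X : measurableType dX} {K : nat}.

(* Ytilde = Y if the (epsilon-)coin Bn is false, else the corrupted draw Yc *)
Definition noisy_label (Y Yc : T -> 'I_K) (Bn : T -> bool) : T -> 'I_K :=
  fun w => if Bn w then Yc w else Y w.

Definition Pmarg (Y : T -> 'I_K) (i : 'I_K) : R := pr [set w | Y w = i].

Definition Pcond (Y Yt : T -> 'I_K) : 'M[R]_K :=
  \matrix_(j, i) cpr [set w | Y w = j] [set w | Yt w = i].

Definition cdf_score (S : X -> 'I_K -> R) (X0 : T -> X) (Y0 : T -> 'I_K) (q : R) : R :=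
  pr [set w | S (X0 w) (Y0 w) <= q].

Definition gfun S X0 (Y Yt : T -> 'I_K) (q : R) : R :=
  cdf_score S X0 Y q - cdf_score S X0 Yt q.

Definition cond_indep_label (X0 : T -> X) (Y Yt : T -> 'I_K) : Prop :=
  forall (A : set X) (i j : 'I_K), measurable A ->
    pr [set w | A (X0 w) /\ Yt w = j /\ Y w = i] * pr [set w | Y w = i]
    = pr [set w | A (X0 w) /\ Y w = i] * pr [set w | Yt w = j /\ Y w = i].

Definition coin_indep (X0 : T -> X) (Y Yc : T -> 'I_K) (Bn : T -> bool) : Prop :=
  forall (A : set X) (C D : set 'I_K) (b : bool), measurable A ->
    pr [set w | A (X0 w) /\ C (Y w) /\ D (Yc w) /\ Bn w = b]
    = pr [set w | A (X0 w) /\ C (Y w) /\ D (Yc w)] * pr [set w | Bn w = b].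

Definition iid_pairs_as (n : nat) (Xs : 'I_n -> T -> X) (Ys : 'I_n -> T -> 'I_K)
  (X0 : T -> X) (Yt : T -> 'I_K) : Prop :=
  (forall (A : 'I_n -> set X) (B : 'I_n -> set 'I_K),
      (forall l, measurable (A l)) ->
      pr (\bigcap_(l in [set: 'I_n]) [set w | A l (Xs l w) /\ B l (Ys l w)])
      = \prod_(l < n) pr [set w | A l (Xs l w) /\ B l (Ys l w)])
  /\ (forall (l : 'I_n) (A : set X) (j : 'I_K), measurable A ->
      pr [set w | A (Xs l w) /\ Ys l w = j] = pr [set w | A (X0 w) /\ Yt w = j]).

(* empirical conditional cdf  Ftilde_n(q; i, j)  (0/0 := 0, as x / 0 = 0) *)
Definition Fn (n : nat) (S : X -> 'I_K -> R) (Xs : 'I_n -> T -> X)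
  (Ys : 'I_n -> T -> 'I_K) (w : T) (q : R) (i j : 'I_K) : R :=
  (\sum_(l < n) ((S (Xs l w) i <= q) && (Ys l w == j))%:R)
  / (\sum_(l < n) (Ys l w == j)%:R).

Definition ghat (n : nat) S (Y Yt : T -> 'I_K) Xs Ys (w : T) (q : R) : R :=
  \sum_(i < K) \sum_(j < K)
     Pmarg Y i * (invmx (Pcond Y Yt)) j i * Fn n S Xs Ys w q i j
  - \sum_(i < K) Pmarg Yt i * Fn n S Xs Ys w q i i.

(* the k-th order statistic (k in 1..size s) *)
Definition order_stat (s : seq R) (k : nat) : R := nth 0 (sort <=%R s) k.-1.

Definition calib_scores (n : nat) (S : X -> 'I_K -> R) Xs Ys (w : T) : seq R :=
  [seq S (Xs l w) (Ys l w) | l <- enum 'I_n].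

Definition bfun (Yt : T -> 'I_K) (n : nat) (j : 'I_K) : R :=
  (1 - Pmarg Yt j) ^+ n + Num.sqrt (pi / (n%:R * Pmarg Yt j)).

Definition Bbound (Y Yt : T -> 'I_K) (n : nat) : R :=
  \sum_(i < K)
    (`|(invmx (Pcond Y Yt)) i i * Pmarg Y i - Pmarg Yt i| * bfun Yt n i
     + \sum_(j < K | j != i)
         `|Pmarg Y i * (invmx (Pcond Y Yt)) j i| * bfun Yt n j).

End noisy_conformal.

(* Main.v *)
Require Import Defs.
From HB Require Import structures.
From mathcomp Require Import all_boot all_order all_algebra.
From mathcomp Require Import all_classical all_reals all_analysis.
From mathcomp Require Import measurable_realfun zify ring lra.
Set Implicit Arguments.
Unset Strict Implicit.
Import Order.TTheory GRing.Theory Num.Theory.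
Import numFieldNormedType.Exports.
Local Open Scope classical_set_scope.
Local Open Scope ring_scope.

(** Conditional independence writes [F(q; i, .)] as the row of the [P(S(X, i)
    <= q | Y = l)] times the matrix [Pcond]; inverting it exhibits both [ghat]
    and [g] as the same combination of the empirical and of the true
    conditional distribution functions, with the weights of [Bbound]. At the
    random threshold, the deviation of [F_n(q; i, j)] from [F(q; i, j)] is at
    most its supremum [D] over all [q], and it remains to bound [E D].

    Let [N] be the number of calibration labels equal to [j]. The sharp DKW
    inequality is not needed, because [E D^2 <= 2 / (m + 1)] given [N = m >= 1]
    has an elementary proof. By Jensen's inequality the true distribution
    function may be replaced by that of a ghost sample of size [m]; by
    exchangeability, the deviation is then at most [1 / m] times the maximum
    [M] of the absolute value of a uniform random bridge with [m] steps up and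
    [m] steps down. The reflection principle gives [P(M >= h) <= 2 'C(2m, m +
    h) / 'C(2m, m)], and [2 h 'C(2m, m + h)] telescopes, so that [E M^2 <= 2m -
    2m / (m + 1)]. Since [E[2 / (N + 1)] <= 2 / ((n + 1) p) <= pi / (n p)] with
    [p = P(Yt = j)], the Cauchy-Schwarz inequality bounds the contribution of
    [N >= 1], while [N = 0] contributes [(1 - p)^n].

    All of this takes place on finite types: with finitely many thresholds,
    only the cells into which the sample falls matter. Right continuity and
    monotone convergence then extend the bound from finite sets of rational
    thresholds to all of them. *)

(** * Sums against product weights *)

(* The expectation of [f] over [n] independent draws when [mu] has mass 1;
   other masses occur too, since [fun=> 1] counts bridges. *)
Fixpoint nfold_sum {R : pzSemiRingType} (Z : finType) (mu : Z -> R) (n : nat)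
    (f : seq Z -> R) : R :=
  if n is m.+1 then \sum_z mu z * nfold_sum mu m (fun s => f (z :: s))
  else f [::].

Section NfoldSumAlgebra.
Context {R : comNzRingType} {Z : finType}.
Implicit Types (mu : Z -> R) (f g : seq Z -> R).

Lemma eq_nfold_sum mu n f g : (forall s, size s = n -> f s = g s) ->
  nfold_sum mu n f = nfold_sum mu n g.
Proof.
elim: n f g => [|n IH] f g fg /=; first exact: fg.
apply: eq_bigr => z _; congr (_ * _).
by apply: IH => s sn; apply: fg; rewrite /= sn.
Qed.

Lemma nfold_sum_sum mu n (I : finType) (a : I -> R) (f : I -> seq Z -> R) :
  nfold_sum mu n (fun s => \sum_i a i * f i s) =
  \sum_i a i * nfold_sum mu n (f i).
Proof.
elim: n f => [|n IH] f //=.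
under eq_bigr => z _ do rewrite IH mulr_sumr.
rewrite exchange_big /=; apply: eq_bigr => i _.
by rewrite mulr_sumr; apply: eq_bigr => z _; rewrite mulrCA.
Qed.

Lemma nfold_sumZ mu n a f :
  nfold_sum mu n (fun s => a * f s) = a * nfold_sum mu n f.
Proof.
elim: n f => [|n IH] f //=; rewrite mulr_sumr.
by apply: eq_bigr => z _; rewrite IH mulrCA.
Qed.

Lemma nfold_sumD mu n f g :
  nfold_sum mu n (fun s => f s + g s) = nfold_sum mu n f + nfold_sum mu n g.
Proof.
elim: n f g => [|n IH] f g //=; rewrite -big_split.
by apply: eq_bigr => z _ /=; rewrite IH mulrDr.
Qed.

Lemma nfold_sum_cst mu n a : nfold_sum mu n (fun=> a) = (\sum_z mu z) ^+ n * a.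
Proof.
elim: n => [|n IH] /=; first by rewrite mul1r.
by under eq_bigr => z _ do rewrite IH; rewrite -mulr_suml exprS mulrA.
Qed.

Lemma nfold_sum_cat mu m n f :
  nfold_sum mu (m + n) f =
  nfold_sum mu m (fun s => nfold_sum mu n (fun t => f (s ++ t))).
Proof. by elim: m f => [|m IH] f //=; apply: eq_bigr => z _; rewrite IH. Qed.

Lemma nfold_sum_scale mu a n f :
  nfold_sum (fun z => a * mu z) n f = a ^+ n * nfold_sum mu n f.
Proof.
elim: n f => [|n IH] f /=; first by rewrite mul1r.
by rewrite mulr_sumr; apply: eq_bigr => z _; rewrite IH exprS; ring.
Qed.

Lemma nfold_sum_tuple mu n f :
  nfold_sum mu n f = \sum_(v : n.-tuple Z) (\prod_(i < n) mu (tnth v i)) * f v.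
Proof.
elim: n f => [|n IH] f.
  rewrite (bigD1 [tuple]) //= big_ord0 mul1r big1 ?addr0 // => v.
  by rewrite tuple0.
rewrite /=; under eq_bigr => z _ do rewrite IH mulr_sumr.
rewrite pair_big /=.
rewrite [RHS](reindex (fun u : Z * n.-tuple Z => [tuple of u.1 :: u.2])) /=.
  apply: eq_bigr => -[z v] _ /=; rewrite big_ord_recl tnth0 mulrA.
  by congr (_ * _ * _); apply: eq_bigr => i _; rewrite tnthS.
exists (fun v : n.+1.-tuple Z => (thead v, [tuple of behead v])).
  by move=> [z v] _ /=; rewrite theadE; congr (_, _); apply: val_inj.
by move=> v _; rewrite /= [RHS]tuple_eta.
Qed.

Lemma nfold_sum_count mu n (a : pred Z) : \sum_z mu z = 1 ->
  nfold_sum mu n (fun s => (count a s)%:R) = n%:R * \sum_(z | a z) mu z.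
Proof.
move=> mu1; elim: n => [|n IH] /=; first by rewrite mul0r.
transitivity (\sum_z (mu z * (a z)%:R + mu z * (n%:R * \sum_(z | a z) mu z))).
  apply: eq_bigr => z _; rewrite -mulrDr -IH; congr (_ * _).
  transitivity (nfold_sum mu n (fun s => (a z)%:R + (count a s)%:R)).
    by apply: eq_nfold_sum => s _; rewrite natrD.
  by rewrite nfold_sumD nfold_sum_cst mu1 expr1n mul1r.
rewrite big_split /= -mulr_suml mu1 mul1r -natr1 mulrDl mul1r addrC.
congr (_ + _); rewrite [RHS]big_mkcond; apply: eq_bigr => z _.
by case: (a z); rewrite ?mulr1 ?mulr0.
Qed.

Lemma nfold_sum_mask mu (b : bitseq) (f : seq Z -> seq Z -> R) :
  nfold_sum mu (size b) (fun s => f (mask b s) (mask (map negb b) s)) =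
  nfold_sum mu (count id b) (fun x => nfold_sum mu (count negb b) (f x)).
Proof.
elim: b f => [|[] b IH] f //=.
  by apply: eq_bigr => z _; rewrite (IH (fun x y => f (z :: x) y)).
rewrite nfold_sum_sum; apply: eq_bigr => z _.
by rewrite (IH (fun x y => f x (z :: y))).
Qed.

End NfoldSumAlgebra.

Lemma nfold_sum_exchange {R : comNzRingType} {Z W : finType} (mu : Z -> R)
    (nu : W -> R) n m (f : seq Z -> seq W -> R) :
  nfold_sum mu n (fun s => nfold_sum nu m (fun t => f s t)) =
  nfold_sum nu m (fun t => nfold_sum mu n (fun s => f s t)).
Proof.
elim: n f => [|n IH] f //=.
by rewrite nfold_sum_sum; apply: eq_bigr => z _; rewrite IH.
Qed.

Lemma big_option {R : nmodType} {Z : finType} (F : option Z -> R) :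
  \sum_o F o = F None + \sum_z F (Some z).
Proof.
rewrite (bigD1 None) //=; congr (_ + _).
rewrite (reindex_omap Some id) /=; last by case.
by apply: eq_bigl => z; rewrite eqxx.
Qed.

(* Given the number [m] of the [n] points that do not fall on [None], these
   points form a sample of size [m] from the conditional law. *)
Lemma nfold_sum_pmap {R : fieldType} {Z : finType} (mu : option Z -> R) n
    (f : seq Z -> R) : mu None != 1 ->
  nfold_sum mu n (fun s => f (pmap id s)) =
  \sum_(m < n.+1) 'C(n, m)%:R * mu None ^+ (n - m) * (1 - mu None) ^+ m *
    nfold_sum (fun z => mu (Some z) / (1 - mu None)) m f.
Proof.
set q := mu None => q1.
under eq_bigr => m _.
  rewrite -mulrA -nfold_sum_scale.
  have -> : (fun z => (1 - q) * (mu (Some z) / (1 - q))) = mu \o Some.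
    by apply/funext => z /=; rewrite mulrC divfK // subr_eq0 eq_sym.
  over.
elim: n f => [|n IH] f; first by rewrite big_ord_recl big_ord0 /= addr0 !mul1r.
rewrite /= big_option /= -/q IH.
have -> : \sum_z mu (Some z) * nfold_sum mu n (fun s => f (z :: pmap id s)) =
    \sum_(m < n.+1) 'C(n, m)%:R * q ^+ (n - m) * nfold_sum (mu \o Some) m.+1 f.
  under [RHS]eq_bigr => m _ do rewrite /= mulr_sumr.
  rewrite [RHS]exchange_big /=; apply: eq_bigr => z _.
  rewrite (IH (fun s => f (z :: s))) mulr_sumr.
  by apply: eq_bigr => m _; rewrite mulrCA.
rewrite [RHS]big_ord_recl [X in q * X]big_ord_recl /=.
rewrite !bin0 !subn0 mulrDr -addrA.
congr (_ + _); first by rewrite !mul1r exprS mulrA.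
under [RHS]eq_bigr => m _ do
  rewrite /bump /= add1n binS natrD mulrDl mulrDl subSS.
rewrite big_split /= [X in _ = X + _]big_ord_recr /= bin_small //.
rewrite !mul0r addr0; congr (_ + _).
rewrite mulr_sumr; apply: eq_bigr => m _ /=.
rewrite /bump /= add1n -(subnSK (ltn_ord m)) exprS; ring.
Qed.

Section NfoldSumOrder.
Context {R : numDomainType} {Z : finType}.
Implicit Types (mu : Z -> R) (f g : seq Z -> R).

Lemma le_nfold_sum mu n f g : (forall z, 0 <= mu z) ->
  (forall s, size s = n -> f s <= g s) -> nfold_sum mu n f <= nfold_sum mu n g.
Proof.
move=> mu0; elim: n f g => [|n IH] f g fg /=; first exact: fg.
apply: ler_sum => z _; apply: ler_wpM2l => //.
by apply: IH => s sn; apply: fg; rewrite /= sn.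
Qed.

Lemma nfold_sum_ge0 mu n f : (forall z, 0 <= mu z) -> (forall s, 0 <= f s) ->
  0 <= nfold_sum mu n f.
Proof.
move=> mu0; elim: n f => [|n IH] f f0 /=; first exact: f0.
by apply: sumr_ge0 => z _; apply: mulr_ge0 => //; exact: IH.
Qed.

End NfoldSumOrder.

Lemma sqr_nfold_sum_le {R : realFieldType} {Z : finType} (mu : Z -> R) n f :
  (forall z, 0 <= mu z) -> \sum_z mu z = 1 ->
  nfold_sum mu n f ^+ 2 <= nfold_sum mu n (fun s => f s ^+ 2).
Proof.
move=> mu0 mu1; set e := nfold_sum mu n f.
have : 0 <= nfold_sum mu n (fun s => (f s - e) ^+ 2).
  by apply: nfold_sum_ge0 => // s; exact: sqr_ge0.
have -> : nfold_sum mu n (fun s => (f s - e) ^+ 2) =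
    nfold_sum mu n (fun s => f s ^+ 2 + (- (2 * e) * f s + e ^+ 2)).
  by apply: eq_nfold_sum => s _; ring.
rewrite !nfold_sumD nfold_sumZ nfold_sum_cst mu1 expr1n mul1r -/e; lra.
Qed.

(** * Splittings of a sequence and random bridges *)

Section Splittings.
Context {R : comNzRingType}.

Definition bit_sum (n : nat) (f : bitseq -> R) : R := nfold_sum (fun=> 1) n f.

Lemma bit_sumS n f : bit_sum n.+1 f =
  bit_sum n (fun b => f (true :: b)) + bit_sum n (fun b => f (false :: b)).
Proof. by rewrite /bit_sum /= big_bool !mul1r. Qed.

Lemma eq_bit_sum n f g : (forall b, size b = n -> f b = g b) ->
  bit_sum n f = bit_sum n g.
Proof. exact: eq_nfold_sum. Qed.

Lemma bit_sum_eq0 n f : (forall b, size b = n -> f b = 0) -> bit_sum n f = 0.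
Proof. by move=> f0; rewrite (eq_bit_sum f0) /bit_sum nfold_sum_cst mulr0. Qed.

Lemma bit_sum_negb n f : bit_sum n (fun b => f (map negb b)) = bit_sum n f.
Proof.
elim: n f => [|n IH] f //; rewrite !bit_sumS /= addrC.
by rewrite (IH (fun b => f (true :: b))) (IH (fun b => f (false :: b))).
Qed.

Lemma bit_sum_count n a :
  bit_sum n (fun b => (count id b == a)%:R) = 'C(n, a)%:R.
Proof.
elim: n a => [|n IH] a; first by rewrite /bit_sum /=; case: a.
rewrite bit_sumS; case: a => [|a].
  rewrite bit_sum_eq0 ?add0r => [|b _ //].
  by under eq_bit_sum => b _ do rewrite /= add0n; rewrite IH !bin0.
by rewrite binS natrD addrC -!IH.
Qed.

Definition split_sum {Z : Type} (f : seq Z -> seq Z -> R) (s : seq Z) : R :=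
  bit_sum (size s) (fun b => f (mask b s) (mask (map negb b) s)).

Lemma split_sum_cat {Z : Type} (f : seq Z -> seq Z -> R) s t :
  split_sum f (s ++ t) = bit_sum (size s) (fun b =>
    split_sum (fun x y => f (mask b s ++ x) (mask (map negb b) s ++ y)) t).
Proof.
rewrite /split_sum size_cat /bit_sum nfold_sum_cat; apply: eq_bit_sum => b sb.
by apply: eq_bit_sum => b' _; rewrite map_cat !mask_cat ?size_map.
Qed.

Lemma split_sum_perm {Z : eqType} (f : seq Z -> seq Z -> R) s t :
  (forall x x' y y', perm_eq x x' -> perm_eq y y' -> f x y = f x' y') ->
  perm_eq s t -> split_sum f s = split_sum f t.
Proof.
move=> f_perm; apply: catCA_perm_subst => s1 s2 s3.
rewrite split_sum_cat [RHS]split_sum_cat.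
under eq_bit_sum => b _ do rewrite split_sum_cat.
under [RHS]eq_bit_sum => b _ do rewrite split_sum_cat.
rewrite /bit_sum nfold_sum_exchange; apply: eq_bit_sum => b _.
apply: eq_bit_sum => b' _; apply: eq_bit_sum => b'' _.
by apply: f_perm; rewrite perm_catCA.
Qed.

Lemma nfold_sum_split {Z : finType} (mu : Z -> R) a b
    (f : seq Z -> seq Z -> R) :
  nfold_sum mu (a + b) (split_sum (fun x y => (size x == a)%:R * f x y)) =
  'C(a + b, a)%:R * nfold_sum mu a (fun x => nfold_sum mu b (f x)).
Proof.
transitivity (bit_sum (a + b) (fun c => (count id c == a)%:R *
    nfold_sum mu (a + b) (fun s => f (mask c s) (mask (map negb c) s)))).
  rewrite /bit_sum; under [RHS]eq_nfold_sum => c _ do rewrite -nfold_sumZ.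
  rewrite -nfold_sum_exchange; apply: eq_nfold_sum => s ss.
  rewrite /split_sum ss; apply: eq_bit_sum => c sc.
  by rewrite size_mask ?sc ?ss.
rewrite -bit_sum_count mulrC -nfold_sumZ; apply: eq_bit_sum => c sc.
rewrite [RHS]mulrC; case: eqP => ca; last by rewrite !mul0r.
have cb : count negb c = b.
  by apply/eqP; rewrite -(eqn_add2l a) -sc -(count_predC id c) ca.
by rewrite !mul1r -sc nfold_sum_mask ca cb.
Qed.

End Splittings.

(* The walk with steps +1 for [true] and -1 for [false] reaches height [h]. *)
Fixpoint hits (h : nat) (b : bitseq) : bool :=
  if h is h'.+1 then
    if b is x :: b' then (if x then hits h' b' else hits h.+1 b') else false
  else true.

Lemma hits0 b : hits 0 b.
Proof. by case: b. Qed.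

Lemma hits_prefix h b k :
  (count negb (take k b) + h <= count id (take k b))%N -> hits h b.
Proof.
elim: b k h => [|x b IH] k [|h] //=; case: k => [|k] //=.
by case: x => /= H; apply: (IH k); lia.
Qed.

Lemma count_negb (b : bitseq) : count negb b = (size b - count id b)%N.
Proof. by have := count_predC id b => <-; rewrite addKn. Qed.

Lemma count_id_map_negb (b : bitseq) : count id (map negb b) = count negb b.
Proof. by rewrite count_map. Qed.

Section Reflection.
Context {R : comNzRingType}.

(* The reflection principle: the right-hand side obeys the first-step recurrence
   of the left-hand side, which is Pascal's rule. *)
Lemma bit_sum_hits a b h : (a <= b + h)%N ->
  bit_sum (a + b) (fun c => ((count id c == a) && hits h c)%:R) =
  'C(a + b, b + h)%:R :> R.
Proof.
move Dn: (a + b)%N => n; elim: n a b h Dn => [|n IH] a b h.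
  by move=> /eqP; rewrite addn_eq0 => /andP[/eqP-> /eqP->]; case: h.
move=> abn abh; case: h abh => [|h] abh.
  rewrite addn0; under eq_bit_sum => c _ do rewrite hits0 andbT.
  by rewrite bit_sum_count -bin_sub; [congr ('C(_, _)%:R); lia|lia].
rewrite bit_sumS addnS binS natrD addrC; congr (_ + _).
  case: b abn abh => [|b] abn abh.
    rewrite bin_small; last lia; apply: bit_sum_eq0 => c sc /=.
    by have := count_size id c; case: eqP => //=; lia.
  have -> : ((b.+1 + h).+1 = b + h.+2)%N by lia.
  by rewrite -(IH a b h.+2) //; lia.
case: a abn abh => [|a] abn abh.
  by rewrite bin_small ?bit_sum_eq0 //; lia.
by rewrite -(IH a b h); [apply: eq_bit_sum|lia|lia].
Qed.

Lemma bit_sum_hits_negb a b h : (b <= a + h)%N ->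
  bit_sum (a + b) (fun c => ((count id c == a) && hits h (map negb c))%:R) =
  'C(a + b, a + h)%:R :> R.
Proof.
move=> bah; rewrite addnC -bit_sum_hits // -[RHS]bit_sum_negb.
apply: eq_bit_sum => c sc; have := count_size id c.
by rewrite count_id_map_negb count_negb sc => ?; congr ((_ && _)%:R); lia.
Qed.

End Reflection.

Lemma sum_mul_bin_central m :
  (\sum_(h < m) h.+1.*2 * 'C(m.*2, m + h.+1) = m * 'C(m.*2, m))%N.
Proof.
case: m => [|m]; first by rewrite big_ord0.
pose tail k := (m.+1.*2 * 'C(m.*2.+1, m.+1 + k))%N.
have telescope k :
    (k.+1.*2 * 'C(m.+1.*2, m.+1 + k.+1) + tail k.+1 = tail k)%N.
  rewrite /tail !doubleS addnS (binS m.*2.+1).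
  have := mul_bin_left m.*2.+1 (m.+1 + k).
  have [km|km] := leqP k m.
    have -> : (m.*2.+1 - (m.+1 + k) = m - k)%N by lia.
    move: ('C(_, (m.+1 + k).+1)) ('C(_, m.+1 + k)) => x y; nia.
  by rewrite !(@bin_small m.*2.+1) ?muln0 ?addn0 ?muln0 //; lia.
have tail0 : (m.+1 * 'C(m.+1.*2, m.+1) = tail 0)%N.
  have eq_mid : 'C(m.*2.+1, m) = 'C(m.*2.+1, m.+1).
    by rewrite -(@bin_sub _ m); [congr ('C(_, _)); lia|lia].
  by rewrite /tail addn0 !doubleS (binS m.*2.+1) eq_mid mulnDr; lia.
have partial_sum k :
    (\sum_(h < k) h.+1.*2 * 'C(m.+1.*2, m.+1 + h.+1) + tail k = tail 0)%N.
  elim: k => [|k IH]; first by rewrite big_ord0.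
  by rewrite big_ord_recr /= -addnA telescope.
rewrite tail0 -(partial_sum m.+1).
by rewrite [tail m.+1]/tail bin_small ?muln0 ?addn0 //; lia.
Qed.

Lemma sum_odd_bin_central m : (0 < m)%N ->
  (m.+1 * \sum_(h < m) h.*2.+1 * ('C(m.*2, m + h.+1)).*2 <=
   (m ^ 2).*2 * 'C(m.*2, m))%N.
Proof.
case: m => // m _.
have first_term : (m.+2 * 'C(m.+1.*2, m.+1 + 1) = m.+1 * 'C(m.+1.*2, m.+1))%N.
  by have := mul_bin_left m.+1.*2 m.+1; rewrite addn1; nia.
have : (\sum_(h < m.+1) h.*2.+1 * ('C(m.+1.*2, m.+1 + h.+1)).*2 +
    \sum_(h < m.+1) ('C(m.+1.*2, m.+1 + h.+1)).*2 =
    (\sum_(h < m.+1) h.+1.*2 * 'C(m.+1.*2, m.+1 + h.+1)).*2)%N.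
  rewrite -big_split -[RHS]mul2n big_distrr; apply: eq_bigr => h _ /=; nia.
rewrite sum_mul_bin_central [X in (_ + X)%N]big_ord_recl /=.
move: (\sum_(h < m.+1) _)%N (\sum_(h < m) _)%N => odd_sum rest; nia.
Qed.

Lemma sum_odd_ltn d m : (d <= m)%N ->
  (\sum_(h < m) h.*2.+1 * (h < d) = d ^ 2)%N.
Proof.
move=> dm; have sum_odd : (\sum_(h < d) h.*2.+1 = d ^ 2)%N.
  by elim: d {dm} => [|d IH]; rewrite ?big_ord0 // big_ord_recr /= IH; nia.
rewrite -sum_odd (big_ord_widen m (fun h => h.*2.+1) dm) [RHS]big_mkcond.
by apply: eq_bigr => h _; rewrite -mulnbr mulnC; case: (h < d)%N.
Qed.

(** * Deviations of empirical distribution functions *)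

Lemma count_mask_sorted (Z : eqType) (leZ : rel Z) (a : pred Z) (s : seq Z) :
  transitive leZ -> (forall x y, leZ x y -> a y -> a x) -> sorted leZ s ->
  exists k, forall b, size b = size s ->
    count a (mask b s) = count id (take k b).
Proof.
move=> leZ_trans a_down; elim: s => [|x s IH] /= xs.
  by exists 0%N => b; rewrite mask0 take0.
have [ax|nax] := boolP (a x).
  have [k kP] := IH (path_sorted xs).
  by exists k.+1 => -[|[] b] //= [sb]; rewrite ?ax kP.
exists 0%N => b _; rewrite take0; apply/eqP; rewrite eqn0Ngt -has_count.
apply/hasPn => y /mem_mask; rewrite inE => /predU1P[-> //|ys].
apply: contra nax => ay; apply: a_down ay.
by have /allP/(_ _ ys) := order_path_min leZ_trans xs.
Qed.

Section Discrepancy.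
Context {disp : Order.disp_t} {Z : finOrderType disp}.
Implicit Types x y s : seq Z.

Definition count_le (t : Z) x : nat := count (fun z => z <= t)%O x.

Definition disc x y : nat := \max_t `|count_le t x - count_le t y|.

Lemma disc_perm x x' y y' : perm_eq x x' -> perm_eq y y' ->
  disc x y = disc x' y'.
Proof.
move=> /permP xx' /permP yy'.
by apply: eq_bigr => t _; rewrite /count_le xx' yy'.
Qed.

Lemma disc_le_size x y : (disc x y <= maxn (size x) (size y))%N.
Proof.
apply/bigmax_leqP => t _.
have count_le_size z : (count_le t z <= size z)%N by exact: count_size.
have := count_le_size x; have := count_le_size y; lia.
Qed.

Lemma hits_disc s b h : sorted <=%O s -> size b = size s ->
  (h < disc (mask b s) (mask (map negb b) s))%N ->
  hits h.+1 b || hits h.+1 (map negb b).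
Proof.
move=> s_sorted sb; apply: contraLR => /norP[/negP nhits /negP nhits'].
rewrite -leqNgt; apply/bigmax_leqP => t _.
have [k kP] := count_mask_sorted le_trans
  (fun u v uv => le_trans uv : (v <= t)%O -> _) s_sorted.
rewrite /count_le !kP ?size_map // -map_take count_id_map_negb.
have count_negbK : count negb (map negb (take k b)) = count id (take k b).
  by rewrite count_map; apply: eq_count => x /=; rewrite negbK.
have := contra_not (@hits_prefix h.+1 b k) nhits.
have := contra_not (@hits_prefix h.+1 (map negb b) k) nhits'.
rewrite -map_take count_id_map_negb count_negbK; lia.
Qed.

Lemma sqr_disc_sorted_le s b m : sorted <=%O s -> size s = m.*2 ->
  size b = m.*2 -> count id b = m ->
  (disc (mask b s) (mask (map negb b) s) ^ 2 <=
   \sum_(h < m) h.*2.+1 * (hits h.+1 b + hits h.+1 (map negb b)))%N.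
Proof.
move=> s_sorted ss sb cb; rewrite -(@sum_odd_ltn _ m).
  apply: leq_sum => h _; rewrite leq_mul2l /=; case: ltnP => // /hits_disc.
  by rewrite sb ss => /(_ s_sorted erefl); case: hits => //; case: hits.
apply: leq_trans (disc_le_size _ _) _.
by rewrite !size_mask ?size_map ?sb ?ss // count_id_map_negb count_negb; lia.
Qed.

Section SecondMoment.
Context {R : realFieldType}.

Lemma split_sum_sqr_disc_le s m : (0 < m)%N -> size s = m.*2 ->
  m.+1%:R * split_sum (fun x y => (size x == m)%:R * (disc x y ^ 2)%:R) s <=
  ((m ^ 2).*2 * 'C(m.*2, m))%:R :> R.
Proof.
move=> m0 ss; rewrite (@split_sum_perm _ _ _ _ (sort <=%O s)); first last.
- by rewrite perm_sym perm_sort.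
- by move=> x x' y y' xx' yy'; rewrite (disc_perm xx' yy') (perm_size xx').
apply: (@le_trans _ _
    (m.+1 * \sum_(h < m) h.*2.+1 * ('C(m.*2, m + h.+1)).*2)%:R); last first.
  by rewrite ler_nat sum_odd_bin_central.
rewrite natrM ler_pM2l ?ltr0n // /split_sum size_sort ss.
apply: (@le_trans _ _ (bit_sum m.*2 (fun b => \sum_(h < m) h.*2.+1%:R *
    (((count id b == m) && hits h.+1 b)%:R +
     ((count id b == m) && hits h.+1 (map negb b))%:R)))).
  apply: le_nfold_sum => // b sb; rewrite size_mask ?size_sort ?sb ?ss //.
  case: eqP => [cb|_]; last by rewrite mul0r sumr_ge0.
  rewrite mul1r /=.
  under eq_bigr => h _ do rewrite -natrD -natrM.
  by rewrite -natr_sum ler_nat sqr_disc_sorted_le ?sort_le_sorted ?size_sort.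
rewrite /bit_sum nfold_sum_sum natr_sum; apply: ler_sum => h _.
rewrite nfold_sumD -[m.*2]addnn -!/(bit_sum _ _).
by rewrite bit_sum_hits ?bit_sum_hits_negb ?leq_addr // -natrD -natrM addnn.
Qed.

Lemma nfold_sum_sqr_disc_le m (mu : Z -> R) : (0 < m)%N ->
  (forall z, 0 <= mu z) -> \sum_z mu z = 1 ->
  nfold_sum mu m (fun x => nfold_sum mu m (fun y => (disc x y ^ 2)%:R)) <=
  (m ^ 2)%:R * 2 / m.+1%:R.
Proof.
move=> m0 mu0 mu1.
have bin_gt0 : 0 < 'C(m + m, m)%:R :> R by rewrite ltr0n bin_gt0 leq_addr.
rewrite ler_pdivlMr ?ltr0n // -(ler_pM2l bin_gt0) mulrA -nfold_sum_split.
rewrite mulrC -nfold_sumZ.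
apply: (@le_trans _ _
    (nfold_sum mu (m + m) (fun=> ((m ^ 2).*2 * 'C(m.*2, m))%:R))).
  apply: le_nfold_sum => // s ss.
  by apply: split_sum_sqr_disc_le; rewrite ?ss ?addnn.
by rewrite nfold_sum_cst mu1 expr1n mul1r natrM -muln2 natrM addnn mulrC.
Qed.

End SecondMoment.

End Discrepancy.

Section SupDeviation.
Context {R : rcfType} {disp : Order.disp_t} {Z : finOrderType disp}.
Implicit Types (mu : Z -> R) (s : seq Z).

Definition sup_dev mu s : R :=
  \big[Num.max/0]_t
    `|(count_le t s)%:R / (size s)%:R - \sum_(z | (z <= t)%O) mu z|.

Lemma sup_dev_nil_le1 mu : (forall z, 0 <= mu z) -> \sum_z mu z = 1 ->
  sup_dev mu [::] <= 1.
Proof.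
move=> mu0 mu1; apply: bigmax_le => // t _.
rewrite mul0r sub0r normrN ger0_norm ?sumr_ge0 // -mu1.
by rewrite [leRHS](bigID (fun z => z <= t)%O) /= lerDl sumr_ge0.
Qed.

(* Jensen's inequality against a ghost sample [y] removes the unknown mean. *)
Lemma sqr_sup_dev_le mu m s : (forall z, 0 <= mu z) -> \sum_z mu z = 1 ->
  (0 < m)%N -> size s = m ->
  sup_dev mu s ^+ 2 <= m%:R ^- 2 * nfold_sum mu m (fun y => (disc s y ^ 2)%:R).
Proof.
move=> mu0 mu1 m0 ss; have m_neq0 : m%:R != 0 :> R by rewrite pnatr_eq0 -lt0n.
rewrite -nfold_sumZ; set B := nfold_sum _ _ _.
have B0 : 0 <= B.
  by apply: nfold_sum_ge0 => // y; rewrite mulr_ge0 ?invr_ge0 ?exprn_ge0.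
apply: (big_ind (fun d => d ^+ 2 <= B)) => [|d e dB eB|t _].
- by rewrite expr0n.
- by rewrite maxEle; case: ifP.
have -> : (count_le t s)%:R / (size s)%:R - \sum_(z | (z <= t)%O) mu z =
    nfold_sum mu m (fun y =>
      m%:R^-1 * ((count_le t s)%:R + (-1) * (count_le t y)%:R)).
  rewrite nfold_sumZ nfold_sumD nfold_sumZ nfold_sum_cst mu1 expr1n mul1r.
  by rewrite nfold_sum_count // ss; field.
rewrite real_normK ?num_real //.
apply: le_trans (sqr_nfold_sum_le _ _ mu0 mu1) _.
apply: le_nfold_sum => // y _; rewrite mulN1r exprMn -exprVn.
rewrite ler_wpM2l ?exprn_ge0 ?invr_ge0 //.
rewrite -[leLHS]real_normK ?num_real // natrX.
apply: lerXn2r; rewrite ?nnegrE //.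
apply: (@le_trans _ _ (`|count_le t s - count_le t y|%N)%:R).
  by rewrite natr_absz intr_norm rmorphB.
rewrite ler_nat.
exact: (leq_bigmax (F := fun t => `|count_le t s - count_le t y|%N) t).
Qed.

Lemma nfold_sum_sqr_sup_dev_le mu m : (forall z, 0 <= mu z) ->
  \sum_z mu z = 1 -> (0 < m)%N ->
  nfold_sum mu m (fun s => sup_dev mu s ^+ 2) <= 2 / m.+1%:R.
Proof.
move=> mu0 mu1 m0.
apply: (@le_trans _ _ (m%:R ^- 2 * nfold_sum mu m (fun s =>
    nfold_sum mu m (fun y => (disc s y ^ 2)%:R)))).
  by rewrite -nfold_sumZ; apply: le_nfold_sum => // s; exact: sqr_sup_dev_le.
apply: le_trans (ler_wpM2l _ (nfold_sum_sqr_disc_le m0 mu0 mu1)) _.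
  by rewrite invr_ge0 exprn_ge0.
by rewrite natrX -mulrA mulKf // expf_neq0 // pnatr_eq0 -lt0n.
Qed.

End SupDeviation.

Lemma sum_binomial_inv_le {R : realFieldType} n (p q : R) :
  0 < p -> 0 <= q -> q + p = 1 ->
  \sum_(m < n.+1) 'C(n, m)%:R * q ^+ (n - m) * p ^+ m / m.+1%:R <=
  (n.+1%:R * p)^-1.
Proof.
move=> p0 q0 qp.
have absorb m : 'C(n, m)%:R / m.+1%:R = 'C(n.+1, m.+1)%:R / n.+1%:R :> R.
  apply/eqP; rewrite eqr_div ?pnatr_eq0 // -!natrM.
  by rewrite mulnC mul_bin_diag mulnC.
have -> : \sum_(m < n.+1) 'C(n, m)%:R * q ^+ (n - m) * p ^+ m / m.+1%:R =
    (n.+1%:R * p)^-1 *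
    \sum_(m < n.+1) 'C(n.+1, m.+1)%:R * q ^+ (n - m) * p ^+ m.+1.
  rewrite mulr_sumr; apply: eq_bigr => m _.
  rewrite mulrAC (mulrAC 'C(n, m)%:R) absorb exprS.
  have : n.+1%:R != 0 :> R by rewrite pnatr_eq0.
  by move: n.+1%:R => k k0; field; rewrite gt_eqF.
rewrite ler_piMr ?invr_ge0 ?mulr_ge0 ?ler0n ?(ltW p0) //.
have := exprDn q p n.+1; rewrite qp expr1n big_ord_recl /= => total.
rewrite -[leLHS]add0r [leRHS]total lerD //.
  by rewrite mulrn_wge0 // mulr_ge0 ?exprn_ge0 // ltW.
by apply: ler_sum => m _; rewrite /bump /= add1n subSS -[leRHS]mulr_natl mulrA.
Qed.

(* [mu] is the law of a point that is discarded when it is [None]. *)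
Section RandomSampleSize.
Context {R : rcfType} {disp : Order.disp_t} {Z : finOrderType disp}.
Variable mu : option Z -> R.
Hypotheses (mu0 : forall o, 0 <= mu o) (mu1 : \sum_o mu o = 1).
Hypothesis muN1 : mu None < 1.

Let q := mu None.
Let nu z := mu (Some z) / (1 - q).

Let p_gt0 : 0 < 1 - q. Proof. by rewrite subr_gt0. Qed.

Let nu0 z : 0 <= nu z. Proof. by rewrite divr_ge0 ?mu0 ?(ltW p_gt0). Qed.

Let nu1 : \sum_z nu z = 1.
Proof.
have total : \sum_z mu (Some z) = 1 - q.
  by rewrite -mu1 big_option addrAC subrr add0r.
by rewrite -mulr_suml total divff // gt_eqF.
Qed.

Lemma nfold_sum_pmap_nil n :
  nfold_sum mu n (fun v => (pmap id v == [::])%:R) = q ^+ n.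
Proof.
elim: n => [|n IH] //=; rewrite big_option /= IH exprS big1 ?addr0 // => z _.
by rewrite nfold_sum_cst !mulr0.
Qed.

Lemma nfold_sum_sqr_sup_dev_pmap_le n :
  nfold_sum mu n
    (fun v => ((pmap id v != [::])%:R * sup_dev nu (pmap id v)) ^+ 2) <=
  2 / (n.+1%:R * (1 - q)).
Proof.
rewrite (nfold_sum_pmap n
  (fun s => ((s != [::])%:R * sup_dev nu s) ^+ 2)) ?lt_eqF // -/q.
apply: (@le_trans _ _ (\sum_(m < n.+1)
    'C(n, m)%:R * q ^+ (n - m) * (1 - q) ^+ m * (2 / m.+1%:R))).
  apply: ler_sum => -[[|m] mn] _.
    by rewrite /= mul0r expr0n mulr0 !mulr_ge0 // exprn_ge0 // mu0.
  apply: ler_wpM2l; first by rewrite !mulr_ge0 ?exprn_ge0 ?mu0 ?(ltW p_gt0).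
  apply: le_trans (nfold_sum_sqr_sup_dev_le nu0 nu1 (ltn0Sn m)).
  by apply: le_nfold_sum => // -[|z s] // _; rewrite mul1r.
under eq_bigr => m _ do rewrite mulrCA.
by rewrite -mulr_sumr ler_wpM2l // sum_binomial_inv_le ?mu0 ?subrKC.
Qed.

Lemma nfold_sum_sup_dev_pmap_le n :
  nfold_sum mu n (fun v => sup_dev nu (pmap id v)) <=
  q ^+ n + Num.sqrt (2 / (n.+1%:R * (1 - q))).
Proof.
pose f v : R := (pmap id v != [::])%:R * sup_dev nu (pmap id v).
apply: (@le_trans _ _
    (nfold_sum mu n (fun v => (pmap id v == [::])%:R + f v))).
  apply: le_nfold_sum => // v _; rewrite /f; case: (pmap id v) => [|z s] /=.
    by rewrite mul0r addr0 sup_dev_nil_le1.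
  by rewrite add0r mul1r.
rewrite nfold_sumD nfold_sum_pmap_nil lerD2l.
apply: le_trans (ler_norm _) _; rewrite -sqrtr_sqr ler_wsqrtr //.
apply: le_trans (sqr_nfold_sum_le _ _ mu0 mu1) _.
exact: nfold_sum_sqr_sup_dev_pmap_le.
Qed.

End RandomSampleSize.

(** * Integrals, finite-valued variables and conditional probabilities *)

Lemma measurable_preimageT {d1 d2 : measure_display} {T1 : measurableType d1}
    {T2 : measurableType d2} (f : T1 -> T2) (A : set T2) :
  measurable_fun setT f -> measurable A -> measurable (f @^-1` A).
Proof. by move=> mf mA; rewrite -[X in measurable X]setTI; exact: mf. Qed.

Lemma measurable_sublevel {d : measure_display} {T : measurableType d}
    {R : realType} (V : T -> R) q :
  measurable_fun setT V -> measurable [set w | V w <= q].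
Proof.
move=> mV; have := measurable_preimageT mV (measurable_itv `]-oo, q]).
by rewrite set_itvE.
Qed.

Lemma cvg_bigmax_ereal_sup {R : realType} (u : nat -> R) :
  (forall r, 0 <= u r) ->
  (\big[Num.max/0]_(t < r) u t)%:E @[r --> \oo] -->
    ereal_sup (range (fun t => (u t)%:E)).
Proof.
move=> u0; have max_nd : {homo (fun r => (\big[Num.max/0]_(t < r) u t)%:E) :
    r s / (r <= s)%N >-> (r <= s)%E}.
  by move=> r s rs; rewrite lee_fin; exact: (le_bigmax_ord xpredT u).
have -> : ereal_sup (range (fun t => (u t)%:E)) =
    ereal_sup (range (fun r => (\big[Num.max/0]_(t < r) u t)%:E)).
  apply/eqP; rewrite eq_le.
  apply/andP; split; apply: ge_ereal_sup => _ [r _ <-].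
    apply: le_trans (ereal_sup_ubound (imageT _ r.+1)); rewrite lee_fin.
    exact: (le_bigmax _ (fun t : 'I_r.+1 => u t) ord_max).
  have sup0 : (0 <= ereal_sup (range (fun t => (u t)%:E)))%E.
    by apply: le_trans (ereal_sup_ubound (imageT _ 0%N)); rewrite lee_fin.
  apply: (big_ind (fun x => (x%:E <= _)%E)) => // [x y xs ys|t _].
    by rewrite maxEle; case: ifP.
  exact: ereal_sup_ubound (imageT _ (t : nat)).
exact: ereal_nondecreasing_cvgn.
Qed.

Section Integrals.
Context {R : realType} {d : measure_display} {T : measurableType d}.
Variable mu : {measure set T -> \bar R}.
Local Open Scope ereal_scope.

(* [ge0_le_integral] would require measuring the integrand of the theorem, which
   involves an order statistic. *)
Lemma ge0_le_integral_total (f g : T -> \bar R) : (forall w, 0 <= f w) ->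
  (forall w, f w <= g w) -> \int[mu]_w f w <= \int[mu]_w g w.
Proof.
move=> f0 fg; have g0 w : 0 <= g w by exact: le_trans (fg w).
rewrite !ge0_integralTE //; apply: ereal_sup_le => _ [h hf <-].
by exists h => // w; apply: le_trans (fg w).
Qed.

Lemma measurable_bigmax (u : nat -> T -> R) r :
  (forall t, measurable_fun setT (u t)) ->
  measurable_fun setT (fun w => \big[Num.max/0%R]_(t < r) u t w).
Proof.
elim: r u => [|r IH] u meas_u.
  by apply: (eq_measurable_fun (cst (0%R : R))) => // w _; rewrite big_ord0.
have mmax := measurable_maxr (meas_u 0%N) (IH _ (fun t => meas_u t.+1)).
by apply: eq_measurable_fun mmax => w _ /=; rewrite big_ord_recl.
Qed.

Section Suprema.
Variable u : nat -> T -> R.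
Hypothesis u0 : forall t w, (0 <= u t w)%R.
Hypothesis meas_u : forall t, measurable_fun setT (u t).

Lemma measurable_ereal_sup :
  measurable_fun setT (fun w => ereal_sup (range (fun t => (u t w)%:E))).
Proof.
apply: (emeasurable_fun_cvg (fun r w => (\big[Num.max/0%R]_(t < r) u t w)%:E)).
  by move=> r; apply/measurable_EFinP; exact: measurable_bigmax.
by move=> w _; exact: cvg_bigmax_ereal_sup.
Qed.

Lemma integral_ereal_sup_le (B : \bar R) :
  (forall r, \int[mu]_w (\big[Num.max/0%R]_(t < r) u t w)%:E <= B) ->
  \int[mu]_w ereal_sup (range (fun t => (u t w)%:E)) <= B.
Proof.
move=> maxB; pose M r w := (\big[Num.max/0%R]_(t < r) u t w)%:E.
have M0 r w : 0 <= M r w by rewrite lee_fin bigmax_ge_id.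
have M_nd w : {homo M^~ w : r s / (r <= s)%N >-> r <= s}.
  move=> r s rs; rewrite lee_fin.
  exact: (le_bigmax_ord xpredT (fun t => u t w)).
have mM r : measurable_fun setT (M r).
  by apply/measurable_EFinP; exact: measurable_bigmax.
have supE w : ereal_sup (range (fun t => (u t w)%:E)) = limn (M^~ w).
  by apply/esym/cvg_lim => //; exact: cvg_bigmax_ereal_sup.
under eq_integral => w _ do rewrite supE.
have cvgM := cvg_monotone_convergence (mu := mu) measurableT mM
  (fun r w _ => M0 r w) (fun w _ => @M_nd w).
rewrite -(cvg_lim _ cvgM) //.
by apply: lime_le; [exact: cvgP cvgM|exact: nearW].
Qed.

End Suprema.

Lemma ge0_integral_le_weighted_sum (I : finType) (a b : I -> R)
    (f : I -> T -> \bar R) (g : T -> \bar R) :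
  (forall i, 0 <= a i)%R -> (forall i w, 0 <= f i w) ->
  (forall i, measurable_fun setT (f i)) ->
  (forall i, \int[mu]_w f i w <= (b i)%:E) -> (forall w, 0 <= g w) ->
  (forall w, g w <= \sum_i (a i)%:E * f i w) ->
  \int[mu]_w g w <= (\sum_i a i * b i)%:E.
Proof.
move=> a0 f0 mf fb g0 gf; apply: le_trans (ge0_le_integral_total g0 gf) _.
have maf i : measurable_fun setT (fun w => (a i)%:E * f i w).
  by apply: emeasurable_funM => //; exact: measurable_cst.
have af0 i w : setT w -> 0 <= (a i)%:E * f i w.
  by move=> _; rewrite mule_ge0 ?lee_fin.
rewrite (ge0_integral_sum mu measurableT maf af0) -sumEFin.
apply: lee_sum => i _; rewrite ge0_integralZl_EFin //.
by rewrite EFinM lee_wpmul2l ?lee_fin.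
Qed.

End Integrals.

Section FiniteValued.
Context {d : measure_display} {T : measurableType d} {V : finType} {z : T -> V}.
Hypothesis mz : forall v, measurable [set w | z w = v].

Lemma measurable_fin_preimage (A : set V) : measurable (z @^-1` A).
Proof.
have -> : z @^-1` A = \bigcup_(v in A) [set w | z w = v].
  by apply/seteqP; split=> [w Aw|w [v] /[swap] /= <- //]; exists (z w).
exact: fin_bigcup_measurable.
Qed.

Lemma fin_comp_indicE {R : pzRingType} (F : V -> R) w :
  F (z w) = \sum_v F v * \1_[set w | z w = v] w.
Proof.
rewrite (bigD1 (z w)) //= indicE mem_set // mulr1 big1 ?addr0 // => v vz.
by rewrite indicE memNset ?mulr0 // => /= zv; rewrite zv eqxx in vz.
Qed.

Lemma measurable_fin_comp {R : realType} (F : V -> R) :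
  measurable_fun setT (F \o z).
Proof.
rewrite (_ : _ \o _ = fun w => \sum_v F v * \1_[set w | z w = v] w).
  apply: measurable_sum => v.
  by apply: measurable_funM => //; exact: measurable_indic.
by apply/funext => w; exact: fin_comp_indicE.
Qed.

End FiniteValued.

Section Probability.
Context {R : realType} {d : measure_display} {T : measurableType d}.
Variable P : probability T R.

Lemma EFin_pr (A : set T) : measurable A -> (pr P A)%:E = P A.
Proof. by move=> mA; rewrite /pr fineK // fin_num_measure. Qed.

Lemma pr_ge0 (A : set T) : 0 <= pr P A.
Proof. by rewrite /pr fine_ge0. Qed.

Lemma pr_set0 : pr P set0 = 0.
Proof. by rewrite /pr measure0. Qed.

Lemma le_pr (A B : set T) : measurable A -> measurable B -> A `<=` B ->
  pr P A <= pr P B.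
Proof. by move=> mA mB AB; rewrite -lee_fin !EFin_pr // le_measure ?inE. Qed.

Lemma subset_pr_eq0 (A B : set T) : measurable A -> measurable B ->
  A `<=` B -> pr P B = 0 -> pr P A = 0.
Proof.
by move=> mA mB AB B0; apply/eqP; rewrite eq_le pr_ge0 andbT -B0 le_pr.
Qed.

Lemma pr_setC (A : set T) : measurable A -> pr P (~` A) = 1 - pr P A.
Proof.
move=> mA; apply: EFin_inj; rewrite EFin_pr; last exact: measurableC.
by rewrite probability_setC // EFinB EFin_pr.
Qed.

Lemma pr_fin_sum {V : finType} (z : T -> V) (A : set T) :
  (forall v, measurable [set w | z w = v]) -> measurable A ->
  pr P A = \sum_v pr P (A `&` [set w | z w = v]).
Proof.
move=> mz mA; have mAz v : measurable (A `&` [set w | z w = v]).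
  exact: measurableI.
apply: EFin_inj; rewrite -sumEFin EFin_pr //.
under eq_bigr => v _ do rewrite EFin_pr //.
have {1}-> : A = \bigcup_(v in [set: V]) (A `&` [set w | z w = v]).
  by apply/seteqP; split=> [w Aw|w [v _ []] //]; exists (z w).
rewrite measure_fin_bigcup //; first last.
- by move=> v v' _ _ [w [[_ <-] [_ <-]]].
- exact: finite_finset.
rewrite [RHS]fsbig_seq ?index_enum_uniq // (_ : [set` index_enum V] = setT) //.
by apply/seteqP; split=> v _ //=; exact: mem_index_enum.
Qed.

Lemma integral_fin_comp {V : finType} (z : T -> V) (F : V -> R) :
  (forall v, measurable [set w | z w = v]) -> (forall v, 0 <= F v) ->
  (\int[P]_w (F (z w))%:E = (\sum_v pr P [set w | z w = v] * F v)%:E)%E.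
Proof.
move=> mz F0; under eq_integral => w _ do rewrite fin_comp_indicE -sumEFin.
have mI v : measurable_fun setT (fun w => (\1_[set w | z w = v] w : R)%:E).
  exact/measurable_EFinP/measurable_indic.
rewrite ge0_integral_sum // => [|v|v w _]; first last.
- by rewrite lee_fin mulr_ge0.
- by apply/measurable_EFinP/measurable_funM => //; exact/measurable_EFinP.
rewrite -sumEFin; apply: eq_bigr => v _.
under eq_integral => w _ do rewrite EFinM.
rewrite ge0_integralZl_EFin // integral_indic // setIT.
by rewrite EFinM EFin_pr // muleC.
Qed.

Lemma cprK (A B : set T) : measurable A -> measurable B ->
  cpr P A B * pr P B = pr P (A `&` B).
Proof.
move=> mA mB; have [PB0|PB0] := eqVneq (pr P B) 0; last by rewrite /cpr divfK.
rewrite PB0 mulr0; apply/esym/(subset_pr_eq0 _ mB) => //.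
exact: measurableI.
Qed.

Lemma cpr_right_continuous (V : T -> R) (B : set T) :
  measurable_fun setT V -> measurable B -> 0 < pr P B ->
  right_continuous (fun q => cpr P [set w | V w <= q] B).
Proof.
move=> mV mB PB q.
pose cond_law : probability T R := mnormalize (mrestr P mB) P.
have cond_lawE t : cond_law (V @^-1` `]-oo, t]) =
    (cpr P [set w | V w <= t] B)%:E.
  have restrE A : mrestr P mB A = P (A `&` B) by [].
  rewrite /cond_law /= /mnormalize /= !restrE setTI -(EFin_pr mB).
  rewrite eqe gt_eqF //= restrE -EFin_pr set_itvE //; apply: measurableI => //.
  exact: measurable_sublevel.
have := @cdf_right_continuous _ T R cond_law (mfun_Sub (mem_set mV)) q.
rewrite /cdf /distribution /pushforward /= cond_lawE => /fine_cvg.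
by apply: cvg_trans; apply: near_eq_cvg; near=> t; rewrite /= cond_lawE.
Unshelve. all: by end_near.
Qed.

End Probability.

(** * Empirical conditional distribution functions *)

Lemma iid_pairs_as_comp {R : realType} {d d1 d2 : measure_display}
    {T : measurableType d} {X1 : measurableType d1} {X2 : measurableType d2}
    {P : probability T R} {K n : nat} {Xs : 'I_n -> T -> X1}
    {Ys : 'I_n -> T -> 'I_K} {X0 : T -> X1} {Y : T -> 'I_K} (f : X1 -> X2) :
  measurable_fun setT f -> iid_pairs_as P n Xs Ys X0 Y ->
  iid_pairs_as P n (fun l => f \o Xs l) Ys (f \o X0) Y.
Proof.
move=> mf [indep law]; split=> [A B mA|l A j mA].
  by apply: (indep (fun l => f @^-1` A l)) => l; exact: measurable_preimageT.
by apply: (law l (f @^-1` A) j); exact: measurable_preimageT.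
Qed.

Section Cells.
Context {R : realType} (G : nat -> R) (r : nat).

Definition cell (x : R) : 'I_r.+1 := inord #|[pred t : 'I_r | G t < x]|.

Lemma cellE x : cell x = #|[pred t : 'I_r | G t < x]| :> nat.
Proof. by rewrite inordK // ltnS -[leqRHS](card_ord r) max_card. Qed.

Lemma le_cell x y : x <= y -> (cell x <= cell y)%N.
Proof.
move=> xy; rewrite !cellE; apply/subset_leq_card/fintype.subsetP => t.
by rewrite !inE => tx; exact: lt_le_trans xy.
Qed.

Lemma cell_le_threshold x t : (t < r)%N ->
  (cell x <= cell (G t))%O = (x <= G t).
Proof.
move=> tr; apply/idP/idP => [|xt]; last exact: le_cell.
apply: contraTT; rewrite -ltNge -ltNge => tx.
rewrite ltEord !cellE; apply: proper_card; apply/properP; split.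
  by apply/fintype.subsetP => u; rewrite !inE => ut; exact: lt_trans tx.
by exists (Ordinal tr); rewrite inE //= ltxx.
Qed.

Lemma measurable_cell c : measurable [set x | cell x = c].
Proof.
apply: is_interval_measurable => x y <- yc z /andP[xz zy].
apply/val_inj/eqP; rewrite eqn_leq -{1}yc.
by rewrite !le_cell.
Qed.

End Cells.

Definition emp_cdf {R : realType} (n : nat) (v : 'I_n -> R) (b : 'I_n -> bool)
    (q : R) : R :=
  (\sum_(l < n) ((v l <= q) && b l)%:R) / \sum_(l < n) (b l)%:R.

Lemma emp_cdf_right_continuous {R : realType} n (v : 'I_n -> R) b :
  right_continuous (emp_cdf v b).
Proof.
move=> q; apply: cvg_near_cst.
have : \forall t \near q^'+, forall l, (v l <= t) = (v l <= q).
  apply: filter_forall => l; have [vq|qv] := leP (v l) q; near=> t.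
    by rewrite (le_trans vq) // ltW.
  by apply/negbTE; rewrite -ltNge; near: t; exact: nbhs_right_lt.
apply: filterS => t same; rewrite /emp_cdf; congr (_ / _).
by apply: eq_bigr => l _; rewrite same.
Unshelve. all: by end_near.
Qed.

Definition rat_seq (R : realType) (a : nat) : R :=
  if unpickle a is Some x then ratr x else 0.

Lemma ereal_sup_rat_seq {R : realType} (f : R -> R) : right_continuous f ->
  ereal_sup (range (fun q => (f q)%:E)) =
  ereal_sup (range (fun a => (f (rat_seq R a))%:E)).
Proof.
move=> f_rc; apply/eqP; rewrite eq_le; apply/andP; split; last first.
  by apply: ereal_sup_le => _ [a _ <-]; exists (rat_seq R a).
apply: ge_ereal_sup => _ [q _ <-]; apply/lee_subgt0Pr => e e0.
have [|d /= d0 fd] := cvgr_ge _ (f_rc q) (f q - e).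
  by rewrite ltrBlDr ltrDl.
have [x] := @rat_in_itvoo R q (q + d) ltac:(by rewrite ltrDl).
rewrite in_itv /= => /andP[qx xd].
apply: le_trans (ereal_sup_ubound (imageT _ (pickle x))).
rewrite -EFinB lee_fin /rat_seq pickleK; apply: fd => //=.
by rewrite distrC gtr0_norm ?subr_gt0 // ltrBlDl.
Qed.

Section ConditionalSample.
Context {R : realType} {d : measure_display} {T : measurableType d}.
Context (P : probability T R) {K n : nat}.
Variables (V0 : T -> R) (L0 : T -> 'I_K) (V : 'I_n -> T -> R).
Variables (L : 'I_n -> T -> 'I_K) (j : 'I_K).
Hypothesis mV0 : measurable_fun setT V0.
Hypothesis mL0 : forall i, measurable [set w | L0 w = i].
Hypothesis mV : forall l, measurable_fun setT (V l).
Hypothesis mL : forall l i, measurable [set w | L l w = i].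
Hypothesis iid : iid_pairs_as P n V L V0 L0.
Hypothesis L0_gt0 : 0 < Pmarg P L0 j.

Definition emp_dev (q : R) (w : T) : R :=
  `|emp_cdf (V^~ w) (fun l => L l w == j) q
    - cpr P [set w | V0 w <= q] [set w | L0 w = j]|.

Lemma emp_dev_ge0 q w : 0 <= emp_dev q w.
Proof. exact: normr_ge0. Qed.

Definition sup_emp_dev (w : T) : \bar R :=
  ereal_sup (range (fun q => (emp_dev q w)%:E)).

Lemma emp_dev_le_sup q w : ((emp_dev q w)%:E <= sup_emp_dev w)%E.
Proof. by apply: ereal_sup_ubound; exists q. Qed.

Lemma sup_emp_dev_ge0 w : (0 <= sup_emp_dev w)%E.
Proof.
by apply: le_trans (emp_dev_le_sup 0 w); rewrite lee_fin emp_dev_ge0.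
Qed.

Section Grid.
Variables (G : nat -> R) (r : nat).

Definition sel_cell (x : R) (y : 'I_K) : option 'I_r.+1 :=
  if y == j then Some (cell G r x) else None.

Definition cell_law (o : option 'I_r.+1) : R :=
  pr P [set w | sel_cell (V0 w) (L0 w) = o].

Definition sample_cells (w : T) : n.-tuple (option 'I_r.+1) :=
  [tuple sel_cell (V l w) (L l w) | l < n].

Let val_set (o : option 'I_r.+1) : set R :=
  if o is Some c then [set x | cell G r x = c] else setT.

Let lab_set (o : option 'I_r.+1) : set 'I_K := [set y | (y == j) = isSome o].

Let sel_cellE x y o : (sel_cell x y = o) = (val_set o x /\ lab_set o y).
Proof.
apply/propext; rewrite /sel_cell /lab_set.
by case: o => [c|] /=; case: (y == j); split=> //; case=> // ->.
Qed.

Let measurable_val_set o : measurable (val_set o).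
Proof. by case: o => [c|] /=; [exact: measurable_cell|exact: measurableT]. Qed.

Let measurable_sel_cell (V' : T -> R) (L' : T -> 'I_K) o :
  measurable_fun setT V' -> (forall i, measurable [set w | L' w = i]) ->
  measurable [set w | sel_cell (V' w) (L' w) = o].
Proof.
move=> mV' mL'; under eq_set => w do rewrite sel_cellE.
apply: measurableI; last exact: measurable_fin_preimage.
exact: (measurable_preimageT mV' (measurable_val_set o)).
Qed.

Let sample_cells_fiber (v : n.-tuple (option 'I_r.+1)) :
  [set w | sample_cells w = v] = \bigcap_(l in [set: 'I_n])
    [set w | val_set (tnth v l) (V l w) /\ lab_set (tnth v l) (L l w)].
Proof.
apply/seteqP; split=> [w <- l _|w cells] /=.
  by rewrite -sel_cellE tnth_mktuple.
apply: eq_from_tnth => l; rewrite tnth_mktuple sel_cellE; exact: cells.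
Qed.

Lemma measurable_sample_cells v : measurable [set w | sample_cells w = v].
Proof.
rewrite sample_cells_fiber; apply: fin_bigcap_measurable => // l _.
under eq_set => w do rewrite -sel_cellE.
exact: measurable_sel_cell.
Qed.

Let sel_cell_Some x y c : (sel_cell x y = Some c) = (cell G r x = c /\ y = j).
Proof. by rewrite sel_cellE; apply/propext; split=> -[? /eqP]. Qed.

Let pr_sel_cell_None (V' : T -> R) (L' : T -> 'I_K) :
  (forall i, measurable [set w | L' w = i]) ->
  pr P [set w | sel_cell (V' w) (L' w) = None] = 1 - pr P [set w | L' w = j].
Proof.
move=> mL'; rewrite -pr_setC //; congr (pr P _); apply/seteqP.
by rewrite /sel_cell; split=> w /=; case: eqP.
Qed.

Let pr_sel_cell l o : pr P [set w | sel_cell (V l w) (L l w) = o] = cell_law o.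
Proof.
have [_ law] := iid; rewrite /cell_law; case: o => [c|].
  under eq_set => w do rewrite sel_cell_Some.
  under [in RHS]eq_set => w do rewrite sel_cell_Some.
  exact: (law l _ j (measurable_cell G c)).
have : pr P (setT `&` [set w | L l w = j]) = pr P (setT `&` [set w | L0 w = j]).
  exact: (law l setT j measurableT).
by rewrite !setTI !pr_sel_cell_None // => ->.
Qed.

Lemma pr_sample_cells v :
  pr P [set w | sample_cells w = v] = \prod_(l < n) cell_law (tnth v l).
Proof.
have [indep _] := iid; rewrite sample_cells_fiber.
rewrite (indep (fun l => val_set (tnth v l)) (fun l => lab_set (tnth v l))) //.
apply: eq_bigr => l _; rewrite -(pr_sel_cell l).
by under [in RHS]eq_set => w do rewrite sel_cellE.
Qed.

Lemma cell_law_ge0 o : 0 <= cell_law o. Proof. exact: pr_ge0. Qed.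

Lemma cell_law_sum : \sum_o cell_law o = 1.
Proof.
have := pr_fin_sum P (fun o => measurable_sel_cell o mV0 mL0) measurableT.
under eq_bigr => o _ do rewrite setTI.
by move=> <-; rewrite /pr probability_setT.
Qed.

Lemma cell_law_None : cell_law None = 1 - Pmarg P L0 j.
Proof. exact: pr_sel_cell_None. Qed.

Lemma cell_law_sum_le t : (t < r)%N ->
  \sum_(c | (c <= cell G r (G t))%O) cell_law (Some c) =
  pr P [set w | V0 w <= G t /\ L0 w = j].
Proof.
move=> tr; have mA : measurable [set w | V0 w <= G t /\ L0 w = j].
  by apply: measurableI (mL0 j); exact: measurable_sublevel.
rewrite (pr_fin_sum P (fun o => measurable_sel_cell o mV0 mL0) mA).
rewrite big_option [X in X + _](_ : _ = 0) ?add0r; last first.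
  rewrite (_ : _ `&` _ = set0) ?pr_set0 //; apply/seteqP; split=> w //=.
  by rewrite /sel_cell => -[[_ ->]]; rewrite eqxx.
rewrite big_mkcond; apply: eq_bigr => c _; case: ifP => ct.
  rewrite setIidr // => w; rewrite /= sel_cell_Some => -[cw Lj].
  by split=> //; rewrite -(cell_le_threshold _ _ tr) cw.
rewrite (_ : _ `&` _ = set0) ?pr_set0 //; apply/seteqP; split=> w //=.
rewrite sel_cell_Some => -[[Vt _] [cw _]].
by rewrite -cw cell_le_threshold // Vt in ct.
Qed.

Lemma emp_cdf_cells t w : (t < r)%N ->
  emp_cdf (V^~ w) (fun l => L l w == j) (G t) =
  (count_le (cell G r (G t)) (pmap id (sample_cells w)))%:R /
  (size (pmap id (sample_cells w)))%:R.
Proof.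
move=> tr; rewrite /emp_cdf -!natr_sum; congr (_%:R / _%:R).
  have countE (v : seq (option 'I_r.+1)) :
      count_le (cell G r (G t)) (pmap id v) =
      count (fun o => if o is Some c then (c <= cell G r (G t))%O else false) v.
    by elim: v => [|[c|] v IH] //=; rewrite -IH.
  rewrite countE -sum1_count [RHS]big_mkcond big_tuple.
  apply: eq_bigr => l _ /=; rewrite tnth_mktuple /sel_cell.
  case: (L l w == j); rewrite ?andbF // andbT.
  by rewrite cell_le_threshold //; case: (_ <= _).
rewrite size_pmap -sum1_count [RHS]big_mkcond big_tuple.
by apply: eq_bigr => l _ /=; rewrite tnth_mktuple /sel_cell; case: (L l w == j).
Qed.

Let cond_law c := cell_law (Some c) / (1 - cell_law None).

Lemma emp_dev_le_sup_dev t w : (t < r)%N ->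
  emp_dev (G t) w <= sup_dev cond_law (pmap id (sample_cells w)).
Proof.
move=> tr; apply: le_trans (le_bigmax _ _ (cell G r (G t))).
rewrite /cond_law -mulr_suml cell_law_sum_le // cell_law_None subKr.
by rewrite /emp_dev emp_cdf_cells.
Qed.

Lemma integral_max_emp_dev_le :
  (\int[P]_w (\big[Num.max/0]_(t < r) emp_dev (G t) w)%:E <=
   ((1 - Pmarg P L0 j) ^+ n +
    Num.sqrt (2 / (n.+1%:R * Pmarg P L0 j)))%:E)%E.
Proof.
apply: le_trans (ge0_le_integral_total (g := fun w =>
    (sup_dev cond_law (pmap id (sample_cells w)))%:E) _ _ _) _ => [w|w|].
- by rewrite lee_fin bigmax_ge_id.
- rewrite lee_fin; apply: bigmax_le => [|t _]; first exact: bigmax_ge_id.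
  exact: emp_dev_le_sup_dev.
rewrite (integral_fin_comp P measurable_sample_cells
  (F := fun v : n.-tuple _ => sup_dev cond_law (pmap id v))); last first.
  by move=> v; exact: bigmax_ge_id.
rewrite lee_fin; under eq_bigr => v _ do rewrite pr_sample_cells.
rewrite -(nfold_sum_tuple cell_law n (fun v => sup_dev cond_law (pmap id v))).
have law_None_lt1 : cell_law None < 1 by rewrite cell_law_None ltrBlDr ltrDl.
apply: le_trans
  (nfold_sum_sup_dev_pmap_le cell_law_ge0 cell_law_sum law_None_lt1 n) _.
by rewrite cell_law_None subKr.
Qed.

End Grid.

Lemma emp_dev_right_continuous w : right_continuous (emp_dev^~ w).
Proof.
move=> q; apply: cvg_norm; apply: cvgB; first exact: emp_cdf_right_continuous.
exact: cpr_right_continuous.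
Qed.

Lemma measurable_emp_dev q : measurable_fun setT (emp_dev q).
Proof.
pose G (t : nat) := q.
pose F (v : n.-tuple (option 'I_2)) : R :=
  `|(count_le (cell G 1 q) (pmap id v))%:R / (size (pmap id v))%:R
    - cpr P [set w | V0 w <= q] [set w | L0 w = j]|.
have -> : emp_dev q = F \o sample_cells G 1.
  by apply/funext => w; rewrite /emp_dev (emp_cdf_cells G w (ltn0Sn 0)).
exact/measurable_fin_comp/measurable_sample_cells.
Qed.

Let sup_emp_dev_rat : sup_emp_dev =
  fun w => ereal_sup (range (fun a => (emp_dev (rat_seq R a) w)%:E)).
Proof.
by apply/funext => w; exact/ereal_sup_rat_seq/emp_dev_right_continuous.
Qed.

Lemma measurable_sup_emp_dev : measurable_fun setT sup_emp_dev.
Proof.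
rewrite sup_emp_dev_rat /=.
apply: measurable_ereal_sup => a; last exact: measurable_emp_dev.
by move=> w; exact: emp_dev_ge0.
Qed.

Lemma integral_sup_emp_dev_le :
  (\int[P]_w sup_emp_dev w <=
   ((1 - Pmarg P L0 j) ^+ n +
    Num.sqrt (2 / (n.+1%:R * Pmarg P L0 j)))%:E)%E.
Proof.
rewrite sup_emp_dev_rat /=.
apply: (integral_ereal_sup_le (u := emp_dev \o rat_seq R)) => [a w|a|r].
- exact: emp_dev_ge0.
- exact: measurable_emp_dev.
exact: integral_max_emp_dev_le.
Qed.

End ConditionalSample.

(** * Inverting the label noise *)

Lemma measurable_noisy_label {d : measure_display} {T : measurableType d}
    {K : nat} (Y Yc : T -> 'I_K) (Bn : T -> bool) :
  (forall i, measurable [set w | Y w = i]) ->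
  (forall i, measurable [set w | Yc w = i]) ->
  measurable [set w | Bn w = true] ->
  forall i, measurable [set w | noisy_label Y Yc Bn w = i].
Proof.
move=> mY mYc mBn i.
have -> : [set w | noisy_label Y Yc Bn w = i] =
    ([set w | Bn w = true] `&` [set w | Yc w = i]) `|`
    (~` [set w | Bn w = true] `&` [set w | Y w = i]).
  apply/seteqP; rewrite /noisy_label; split=> w /=; case: (Bn w) => //.
  - by left.
  - by right.
  - by case=> -[].
  - by case=> -[].
by apply: measurableU; apply: measurableI => //; exact: measurableC.
Qed.

Section LabelInversion.
Context {R : realType} {d : measure_display} {T : measurableType d}.
Context (P : probability T R) {dX : measure_display} {X : measurableType dX}.
Context {K : nat}.
Variables (X0 : T -> X) (Y Yt : T -> 'I_K).
Hypothesis mX0 : measurable_fun setT X0.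
Hypothesis mY : forall i, measurable [set w | Y w = i].
Hypothesis mYt : forall i, measurable [set w | Yt w = i].
Hypothesis cind : cond_indep_label P X0 Y Yt.
Hypothesis Pcond_unit : Pcond P Y Yt \in unitmx.

Lemma cpr_noisy_label (A : set X) j : measurable A ->
  cpr P (X0 @^-1` A) [set w | Yt w = j] =
  \sum_l cpr P (X0 @^-1` A) [set w | Y w = l] * Pcond P Y Yt l j.
Proof.
move=> mA; have mXA := measurable_preimageT mX0 mA.
rewrite {1}/cpr (pr_fin_sum P mY) //; last exact: measurableI.
rewrite mulr_suml; apply: eq_bigr => l _.
rewrite mxE {2}/cpr mulrA; congr (_ / _).
have mYtl : measurable ([set w | Yt w = j] `&` [set w | Y w = l]).
  exact: measurableI.
have mAYtl := measurableI _ _ mXA mYtl.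
rewrite -setIA [X in _ * pr P X]setIC.
have [Pl0|Pl0] := eqVneq (Pmarg P Y l) 0.
  have null_sub (B : set T) mB Bl :=
    subset_pr_eq0 (A := B) mB (mY l) Bl Pl0.
  by rewrite !null_sub ?mulr0 // => w [] // _ [].
apply: (mulIf Pl0); rewrite [LHS](cind l j mA) mulrAC.
by congr (_ * _); rewrite cprK.
Qed.

Lemma cpr_clean_label (A : set X) i : measurable A ->
  cpr P (X0 @^-1` A) [set w | Y w = i] =
  \sum_j cpr P (X0 @^-1` A) [set w | Yt w = j] * invmx (Pcond P Y Yt) j i.
Proof.
move=> mA; pose clean := \row_l cpr P (X0 @^-1` A) [set w | Y w = l].
pose noisy := \row_j cpr P (X0 @^-1` A) [set w | Yt w = j].
have noisyE : noisy = clean *m Pcond P Y Yt.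
  apply/rowP => j; rewrite !mxE cpr_noisy_label //.
  by apply: eq_bigr => l _; rewrite !mxE.
have /rowP/(_ i) := mulmxK Pcond_unit clean; rewrite -noisyE !mxE => <-.
by apply: eq_bigr => j _; rewrite !mxE.
Qed.

Variable S : X -> 'I_K -> R.
Hypothesis mS : forall i, measurable_fun setT (S^~ i).

Lemma cdf_score_sum (L : T -> 'I_K) q :
  (forall i, measurable [set w | L w = i]) ->
  cdf_score P S X0 L q =
  \sum_i Pmarg P L i * cpr P [set w | S (X0 w) i <= q] [set w | L w = i].
Proof.
move=> mL; have mSX i : measurable [set w | S (X0 w) i <= q].
  exact: (measurable_preimageT mX0 (measurable_sublevel q (mS i))).
have scoreI i : [set w | S (X0 w) (L w) <= q] `&` [set w | L w = i] =
    [set w | S (X0 w) i <= q] `&` [set w | L w = i].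
  by apply/seteqP; split=> w /= [Sq Li]; split=> //; rewrite ?Li // -Li.
rewrite /cdf_score (pr_fin_sum P mL); last first.
  rewrite (_ : [set w | _] = \bigcup_(i in [set: 'I_K])
      ([set w | S (X0 w) i <= q] `&` [set w | L w = i])).
    by apply: fin_bigcup_measurable => // i _; exact: measurableI.
  apply/seteqP; split=> [w Sq|w [i _ [/= Sq Li]]]; first by exists (L w).
  by rewrite Li.
by apply: eq_bigr => i _; rewrite scoreI mulrC cprK.
Qed.

Definition weight (i j : 'I_K) : R :=
  Pmarg P Y i * invmx (Pcond P Y Yt) j i - (j == i)%:R * Pmarg P Yt i.

Lemma sum_weight (F : 'I_K -> 'I_K -> R) :
  \sum_i \sum_j weight i j * F i j =
  \sum_i \sum_j Pmarg P Y i * invmx (Pcond P Y Yt) j i * F i j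
  - \sum_i Pmarg P Yt i * F i i.
Proof.
rewrite -sumrB; apply: eq_bigr => i _; rewrite /weight.
under eq_bigr => j _ do rewrite mulrBl.
rewrite sumrB; congr (_ - _); rewrite (bigD1 i) //= eqxx mul1r big1 ?addr0 //.
by move=> j /negbTE ->; rewrite !mul0r.
Qed.

Lemma gfun_weight q : gfun P S X0 Y Yt q = \sum_i \sum_j
  weight i j * cpr P [set w | S (X0 w) i <= q] [set w | Yt w = j].
Proof.
rewrite sum_weight /gfun !cdf_score_sum //; congr (_ - _).
apply: eq_bigr => i _.
rewrite (cpr_clean_label i (measurable_sublevel q (mS i))) mulr_sumr.
by apply: eq_bigr => j _; rewrite mulrCA mulrC.
Qed.

Lemma Bbound_weight n : Bbound P Y Yt n =
  \sum_(ij : 'I_K * 'I_K) `|weight ij.1 ij.2| * bfun P Yt n ij.2.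
Proof.
rewrite -(pair_bigA _ (fun i j => `|weight i j| * bfun P Yt n j)) /=.
apply: eq_bigr => i _; rewrite [RHS](bigD1 i) //=; congr (_ + _).
  by rewrite /weight eqxx mul1r [Pmarg P Y i * _]mulrC.
by apply: eq_bigr => j /negbTE ji; rewrite /weight ji mul0r subr0.
Qed.

Lemma ghat_dev_le n (Xs : 'I_n -> T -> X) (Ys : 'I_n -> T -> 'I_K) w q :
  (`|ghat P n S Y Yt Xs Ys w q - gfun P S X0 Y Yt q|%:E <=
   \sum_(ij : 'I_K * 'I_K) `|weight ij.1 ij.2|%:E *
     sup_emp_dev P (fun w => S (X0 w) ij.1) Yt
       (fun l w => S (Xs l w) ij.1) Ys ij.2 w)%E.
Proof.
have -> : ghat P n S Y Yt Xs Ys w q =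
    \sum_i \sum_j weight i j * Fn n S Xs Ys w q i j by rewrite sum_weight.
rewrite gfun_weight -sumrB; under eq_bigr => i _ do rewrite -sumrB.
rewrite pair_bigA /=; under eq_bigr => ij _ do rewrite -mulrBr.
apply: (@le_trans _ _ (\sum_ij `|weight ij.1 ij.2 *
    (Fn n S Xs Ys w q ij.1 ij.2 -
     cpr P [set w | S (X0 w) ij.1 <= q] [set w | Yt w = ij.2])|)%:E).
  by rewrite lee_fin; exact: ler_norm_sum.
rewrite -sumEFin; apply: lee_sum => ij _.
by rewrite normrM EFinM lee_wpmul2l ?lee_fin // emp_dev_le_sup.
Qed.

End LabelInversion.

Lemma le_bfun {R : realType} {d : measure_display} {T : measurableType d}
    (P : probability T R) {K : nat} (Yt : T -> 'I_K) n j :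
  (0 < n)%N -> 0 < Pmarg P Yt j ->
  (1 - Pmarg P Yt j) ^+ n + Num.sqrt (2 / (n.+1%:R * Pmarg P Yt j)) <=
  bfun P Yt n j.
Proof.
move=> n0 p0; rewrite lerD2l ler_wsqrtr // ler_pM ?pi_ge2 //.
  by rewrite invr_ge0 mulr_ge0 // ltW.
by rewrite lef_pV2 ?posrE ?mulr_gt0 ?ltr0n // ler_pM2r // ler_nat.
Qed.

Unset Implicit Arguments.

Theorem theorem1 (R : realType) (d : measure_display) (T : measurableType d)
  (P : probability T R) (dX : measure_display) (X : measurableType dX)
  (K : nat) (eps : R) (S : X -> 'I_K -> R)
  (X0 : T -> X) (Y Yc : T -> 'I_K) (Bn : T -> bool)
  (n : nat) (Xs : 'I_n -> T -> X) (Ys : 'I_n -> T -> 'I_K) (k : nat) :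
  (2 <= K)%N ->
  0 < eps < 1 / 2 ->
  (forall i : 'I_K, measurable_fun setT (fun x => S x i)) ->
  measurable_fun setT X0 ->
  (forall i : 'I_K, measurable [set w | Y w = i]) ->
  (forall i : 'I_K, measurable [set w | Yc w = i]) ->
  measurable [set w | Bn w = true] ->
  pr P [set w | Bn w = true] = eps ->
  coin_indep P X0 Y Yc Bn ->
  cond_indep_label P X0 Y (noisy_label Y Yc Bn) ->
  (forall i : 'I_K, 0 < Pmarg P (noisy_label Y Yc Bn) i) ->
  Pcond P Y (noisy_label Y Yc Bn) \in unitmx ->
  (forall l : 'I_n, measurable_fun setT (Xs l)) ->
  (forall (l : 'I_n) (i : 'I_K), measurable [set w | Ys l w = i]) ->
  iid_pairs_as P n Xs Ys X0 (noisy_label Y Yc Bn) ->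
  (1 <= k <= n)%N ->
  (\int[P]_w
     (`| ghat P n S Y (noisy_label Y Yc Bn) Xs Ys w
           (order_stat (calib_scores n S Xs Ys w) k)
         - gfun P S X0 Y (noisy_label Y Yc Bn)
           (order_stat (calib_scores n S Xs Ys w) k) |)%:E
   <= (Bbound P Y (noisy_label Y Yc Bn) n)%:E)%E.
Proof.
move=> _ _ mS mX0 mY mYc mBn _ _ cind Yt_gt0 unitP mXs mYs iid /andP[k1 kn].
have n0 : (0 < n)%N by exact: leq_trans kn.
have mYt := measurable_noisy_label mY mYc mBn.
set Yt := noisy_label Y Yc Bn in cind Yt_gt0 unitP iid mYt *.
have mSX i (Z : T -> X) : measurable_fun setT Z ->
    measurable_fun setT (fun w => S (Z w) i).
  by move=> mZ; have := measurableT_comp (mS i) mZ.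
pose D (ij : 'I_K * 'I_K) := sup_emp_dev P (fun w => S (X0 w) ij.1) Yt
  (fun l w => S (Xs l w) ij.1) Ys ij.2.
rewrite Bbound_weight; apply: (ge0_integral_le_weighted_sum (f := D)) => //.
- by move=> ij w; exact: sup_emp_dev_ge0.
- by move=> [i j]; apply: measurable_sup_emp_dev => // *; exact: mSX.
- move=> [i j]; apply: le_trans (integral_sup_emp_dev_le _ _ _ _ _ _) _ => //.
  + exact: mSX.
  + by move=> l; exact: mSX.
  + exact: (iid_pairs_as_comp (mS i) iid).
  + by rewrite lee_fin le_bfun.
by move=> w; exact: ghat_dev_le.
Qed.
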